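(* Let $k$ be an infinite field, let $S$ be a numerical semigroup, and let $R=k[[t^S]]$. If the Hilbert function $H_R$ is decreasing at $h=2$, i.e. $H_R(1)>H_R(2)$, then $\mathrm{e.d.}(S)>5$.
   Context: A numerical semigroup $S$ is a subsemigroup of $(\mathbb{N},+)$ containing $0$; $S=\langle g_1,\dots,g_n\rangle$ means that $g_1<g_2<\dots<g_n$ is its minimal set of generators, and it is assumed that $\gcd(g_1,\dots,g_n)=1$ (equivalently $\mathbb{N}\setminus S$ is finite). The embedding dimension $\mathrm{e.d.}(S)$ is the cardinality $n$ of the minimal set of generators. Put $M=S\setminus\{0\}$, $0M=S$, and for $h\ge 1$ let $hM=\{m_1+\dots+m_h : m_1,\dots,m_h\in M\}$. The semigroup ring is $R=k[[t^S]]=k[[t^{g_1},\dots,t^{g_n}]]$, a one-dimensional local domain with maximal ideal $\mathfrak{m}=(t^{g_1},\dots,t^{g_n})$. Its Hilbert function is $H_R(h)=\dim_k \mathfrak{m}^h/\mathfrak{m}^{h+1}$ for $h\ge 0$ (with $\mathfrak{m}^0=R$), and one has $H_R(h)=|hM\setminus (h+1)M|$ for all $h\ge 0$. ''Decreasing at $h$'' means $H_R(h-1)>H_R(h)$. *)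

(* Defs.v *)
From HB Require Import structures.
From mathcomp Require Import all_boot all_algebra finmap.
From mathcomp Require Import mathcomp_extra boolp classical_sets functions.
From mathcomp Require Import cardinality.

Set Implicit Arguments.
Unset Strict Implicit.
Unset Printing Implicit Defensive.

Import GRing.Theory.
Local Open Scope classical_set_scope.
Local Open Scope ring_scope.

Record numSemigroup := NumSemigroup {
  nsg_set :> set nat;
  nsg0 : nsg_set 0%N;
  nsgD : forall a b : nat, nsg_set a -> nsg_set b -> nsg_set (a + b)%N;
  nsg_cofinite : finite_set (~` nsg_set) }.

Definition nsg_generated (A : set nat) : set nat :=
  [set n | exists s : seq nat, (forall a, a \in s -> A a) /\ n = sumn s].

Definition is_min_gens (S A : set nat) : Prop :=
  nsg_generated A = S /\
  forall B : set nat, B `<=` A -> nsg_generated B = S -> B = A.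

(* The minimal set of generators; the default value is never used, see
   [min_gensP], and the choice is the only possible one, see
   [is_min_gens_unique]. *)
Definition min_gens (S : numSemigroup) : set nat :=
  xget set0 [set A | is_min_gens S A].

Definition embdim (S : numSemigroup) : nat := #|` fset_set (min_gens S)|.

Section MinGens.
Variable S : numSemigroup.

Let atoms : set nat := [set a | [/\ nsg_set S a, a <> 0%N &
  forall b c, nsg_set S b -> nsg_set S c ->
    a = (b + c)%N -> b = 0%N \/ c = 0%N]].

Let sumn_nsg (A : set nat) (s : seq nat) :
  A `<=` S -> (forall a, a \in s -> A a) -> nsg_set S (sumn s).
Proof.
move=> AS; elim: s => [|a s IHs] As /=; first exact: nsg0.
apply: nsgD; first by apply/AS/As; rewrite mem_head.
by apply: IHs => b bs; apply: As; rewrite inE bs orbT.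
Qed.

Let atoms_gen : nsg_generated atoms = S.
Proof.
apply/seteqP; split=> [n [s [As ->]]|n].
  by apply: (sumn_nsg (A := atoms)) => // a [].
elim/ltn_ind: n => n IHn Sn.
have [->|/eqP n0] := eqVneq n 0%N; first by exists [::].
have [an|nan] := pselect (atoms n).
  by exists [:: n]; split=> [a|] /=; rewrite ?addn0// inE => /eqP->.
have [b [c [Sb Sc nbc b0 c0]]] : exists b c,
    [/\ nsg_set S b, nsg_set S c, n = (b + c)%N, (0 < b)%N & (0 < c)%N].
  apply: contrapT => nbc; apply: nan; split=> //.
  move=> b c Sb Sc e; apply: contrapT => /not_orP[/eqP b0 /eqP c0].
  by apply: nbc; exists b, c; rewrite !lt0n.
have [|sb [Ab eb]] := IHn b _ Sb; first by rewrite nbc -addn1 leq_add2l.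
have [|sc [Ac ec]] := IHn c _ Sc; first by rewrite nbc -add1n leq_add2r.
exists (sb ++ sc); split; last by rewrite sumn_cat -eb -ec.
by move=> a; rewrite mem_cat => /orP[/Ab|/Ac].
Qed.

Let gen_sub (B : set nat) : nsg_generated B = S -> B `<=` S.
Proof.
move=> <- b Bb; exists [:: b]; split=> [a|] /=; last by rewrite addn0.
by rewrite inE => /eqP->.
Qed.

Let atoms_sub (B : set nat) : nsg_generated B = S -> atoms `<=` B.
Proof.
move=> genB a [Sa a0 airr].
have BS := gen_sub genB.
have [s [Bs ea]] : nsg_generated B a by rewrite genB.
elim: s Bs ea => [|b s IHs] Bs /= ea; first by rewrite ea in a0.
have Bb : B b by apply: Bs; rewrite mem_head.
have Bs' c : c \in s -> B c by move=> cs; apply: Bs; rewrite inE cs orbT.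
have [b0|s0] := airr b (sumn s) (BS _ Bb) (sumn_nsg BS Bs') ea.
  by apply: IHs => //; rewrite ea b0.
by rewrite ea s0 addn0.
Qed.

Let atoms_min : is_min_gens S atoms.
Proof.
split=> [|B BA genB]; first exact: atoms_gen.
by apply/seteqP; split=> //; apply: atoms_sub.
Qed.

Lemma is_min_gens_unique (A B : set nat) :
  is_min_gens S A -> is_min_gens S B -> A = B.
Proof.
suff H C : is_min_gens S C -> C = atoms by move=> /H-> /H->.
by move=> [genC minC]; rewrite (minC atoms)//; apply: atoms_sub.
Qed.

Lemma min_gensP : is_min_gens S (min_gens S).
Proof. exact: (xgetI set0 atoms_min). Qed.

Lemma finite_min_gens : finite_set (min_gens S).
Proof.
rewrite (is_min_gens_unique min_gensP atoms_min).
have [N SN] : exists N, forall n, (N <= n)%N -> nsg_set S n.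
  have /finite_seqP[s es] := nsg_cofinite S.
  exists (\max_(i <- s) i).+1 => n lt_n; apply: contrapT => Sn.
  have ns : n \in s by have : (~` S) n by []; rewrite es.
  have : (n <= \max_(i <- s) i)%N by apply: (leq_bigmax_seq (F := id)).
  by rewrite leqNgt lt_n.
apply: (sub_finite_set _ (finite_II (N.+1 + N.+1)%N)) => a [Sa a0 airr] /=.
rewrite ltnNge; apply/negP => le_a.
have le1 : (N.+1 <= a)%N by apply: leq_trans le_a; rewrite leq_addr.
have le2 : (N.+1 <= a - N.+1)%N by rewrite leq_subRL.
have [//|e] := airr _ _ (SN _ (leqnSn N)) (SN _ (ltnW le2)) (esym (subnKC le1)).
by rewrite e in le2.
Qed.

End MinGens.

Section Ideals.
Variable R : comNzRingType.

Definition ideal_gen (X : set R) : set R :=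
  [set x | exists (n : nat) (a y : 'I_n -> R),
    (forall i, X (y i)) /\ x = \sum_(i < n) a i * y i].

Definition ideal_mul (I J : set R) : set R :=
  ideal_gen [set x * y | x in I & y in J].

Fixpoint ideal_exp (I : set R) (h : nat) : set R :=
  if h is h'.+1 then ideal_mul I (ideal_exp I h') else setT.

End Ideals.

(* [v] is a family of vectors of [A] whose classes form a basis of the quotient
   of [A] by its subspace [B]. *)
Definition quo_basis (k : fieldType) (V : lmodType k) (A B : set V) (n : nat)
    (v : 'I_n -> V) : Prop :=
  [/\ forall i, A (v i),
      forall x, A x -> exists c : 'I_n -> k, B (x - \sum_(i < n) c i *: v i)
    & forall c : 'I_n -> k, B (\sum_(i < n) c i *: v i) -> forall i, c i = 0].

(* dim (A / B), with the default value 0 when A / B is not of finite dimension *)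
Definition quo_dim (k : fieldType) (V : lmodType k) (A B : set V) : nat :=
  xget 0%N [set n | exists v : 'I_n -> V, quo_basis A B v].

Definition hilbert (k : fieldType) (R : comAlgType k) (m : set R) (h : nat) :
    nat :=
  quo_dim (ideal_exp m h) (ideal_exp m h.+1).

(* A wrapper, because [nat -> k] already carries the pointwise product. *)
Record fps (k : Type) := Fps { fps_coef : nat -> k }.

HB.instance Definition _ (k : Type) := [isNew for @fps_coef k].
HB.instance Definition _ (k : choiceType) := [Choice of fps k by <:].

Section PowerSeries.
Variable k : fieldType.
Implicit Types f g : fps k.

Lemma fpsP f g : fps_coef f =1 fps_coef g <-> f = g.
Proof. by split=> [/funext/val_inj|->]. Qed.

Definition fps_zero : fps k := Fps (fun=> 0).
Definition fps_opp f := Fps (fun n => - fps_coef f n).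
Definition fps_add f g := Fps (fun n => fps_coef f n + fps_coef g n).
Definition fps_Xn (s : nat) : fps k := Fps (fun n => (n == s)%:R).
Definition fps_mul f g :=
  Fps (fun n => \sum_(i < n.+1) fps_coef f i * fps_coef g (n - i)%N).
Definition fps_scale (c : k) f := Fps (fun n => c * fps_coef f n).

Let addA : associative fps_add.
Proof. by move=> f g h; apply/fpsP => n /=; rewrite addrA. Qed.
Let addC : commutative fps_add.
Proof. by move=> f g; apply/fpsP => n /=; rewrite addrC. Qed.
Let add0 : left_id fps_zero fps_add.
Proof. by move=> f; apply/fpsP => n /=; rewrite add0r. Qed.
Let addN : left_inverse fps_zero fps_opp fps_add.
Proof. by move=> f; apply/fpsP => n /=; rewrite addNr. Qed.

HB.instance Definition _ := GRing.isZmodule.Build (fps k) addA addC add0 addN.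

Let trunc (N : nat) f : {poly k} := \poly_(i < N) fps_coef f i.

Let coef_mul_trunc N f g n : (n < N)%N ->
  fps_coef (fps_mul f g) n = (trunc N f * trunc N g)`_n.
Proof.
move=> nN; rewrite coefM; apply: eq_bigr => -[i /= lei] _.
by rewrite !coef_poly (leq_ltn_trans _ nN)// (leq_ltn_trans (leq_subr _ _) nN).
Qed.

Let mulC : commutative fps_mul.
Proof.
by move=> f g; apply/fpsP => n; rewrite !(@coef_mul_trunc n.+1)// mulrC.
Qed.

Let mulA : associative fps_mul.
Proof.
move=> f g h; apply/fpsP => n.
transitivity ((trunc n.+1 f * trunc n.+1 g * trunc n.+1 h)`_n).
  rewrite -mulrA coefM; apply: eq_bigr => i _; rewrite coef_poly ltn_ord.
  by congr (_ * _); apply/coef_mul_trunc; rewrite ltnS leq_subr.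
rewrite coefM; apply: eq_bigr => i _; rewrite [in LHS]coef_poly ltnS leq_subr.
by congr (_ * _); apply/esym/coef_mul_trunc/ltn_ord.
Qed.

Let mul1 : left_id (fps_Xn 0) fps_mul.
Proof.
move=> f; apply/fpsP => n /=; rewrite big_ord_recl subn0 mul1r.
by rewrite big1 ?addr0// => i _; rewrite mul0r.
Qed.

Let mulD : left_distributive fps_mul fps_add.
Proof.
move=> f g h; apply/fpsP => n /=; rewrite -big_split.
by apply: eq_bigr => i _; rewrite mulrDl.
Qed.

Let oneN0 : fps_Xn 0 != 0.
Proof. by apply/eqP => /fpsP/(_ 0%N)/eqP; rewrite /= oner_eq0. Qed.

HB.instance Definition _ :=
  GRing.Zmodule_isComNzRing.Build (fps k) mulA mulC mul1 mulD oneN0.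

Let scaleA c d f : fps_scale c (fps_scale d f) = fps_scale (c * d) f.
Proof. by apply/fpsP => n /=; rewrite mulrA. Qed.
Let scale1 : left_id 1 fps_scale.
Proof. by move=> f; apply/fpsP => n /=; rewrite mul1r. Qed.
Let scaleDr : right_distributive fps_scale +%R.
Proof. by move=> c f g; apply/fpsP => n /=; rewrite mulrDr. Qed.
Let scaleDl f : {morph fps_scale^~ f : c d / c + d}.
Proof. by move=> c d; apply/fpsP => n /=; rewrite mulrDl. Qed.

HB.instance Definition _ :=
  GRing.Zmodule_isLmodule.Build k (fps k) scaleA scale1 scaleDr scaleDl.

Let scaleAl (c : k) (f g : fps k) : c *: (f * g) = (c *: f) * g.
Proof.
apply/fpsP => n /=; rewrite mulr_sumr.
by apply: eq_bigr => i _; rewrite mulrA.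
Qed.

HB.instance Definition _ := GRing.Lmodule_isLalgebra.Build k (fps k) scaleAl.
HB.instance Definition _ := GRing.Lalgebra_isComAlgebra.Build k (fps k).

End PowerSeries.

Section SemigroupRing.
Variables (k : fieldType) (S : numSemigroup).

Definition fps_supp : {pred fps k} :=
  fun f => `[< forall n, ~ nsg_set S n -> fps_coef f n = 0 >].

Let supp_subalg : subalg_closed fps_supp.
Proof.
split=> [|c f g /asboolP Sf /asboolP Sg|f g /asboolP Sf /asboolP Sg];
  apply/asboolP => n Sn /=.
- by case: eqP => // n0; case: Sn; rewrite n0; apply: nsg0.
- by rewrite Sf// Sg// mulr0 addr0.
- rewrite big1// => -[i /= lei] _.
  have [Si|/Sf->] := pselect (nsg_set S i); last by rewrite mul0r.
  rewrite Sg ?mulr0// => Sni; apply: Sn.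
  by rewrite -(subnKC (lei : (i <= n)%N)); apply: nsgD.
Qed.

HB.instance Definition _ :=
  GRing.isSubalgClosed.Build k (fps k) fps_supp supp_subalg.

Record sgring := SgRing { sgring_val : fps k; _ : sgring_val \in fps_supp }.

HB.instance Definition _ := [isSub for sgring_val].
HB.instance Definition _ := [Choice of sgring by <:].
HB.instance Definition _ := [SubChoice_isSubComNzRing of sgring by <:].
HB.instance Definition _ := [SubZmodule_isSubLmodule of sgring by <:].
HB.instance Definition _ := [SubNzRing_SubLmodule_isSubLalgebra of sgring by <:].
HB.instance Definition _ := [SubLalgebra_isSubAlgebra of sgring by <:].

(* The ideal (t^g_1, ..., t^g_n), for g_1, ..., g_n the minimal generators. *)
Definition sgring_max : set sgring :=
  ideal_gen [set x | exists2 g, min_gens S g & sgring_val x = fps_Xn k g].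

End SemigroupRing.

Arguments sgring_max k S : clear implicits.

(* Main.v *)
From HB Require Import structures.
Require Import Defs.
From mathcomp Require Import all_boot all_algebra finmap zify.
From mathcomp Require Import boolp classical_sets cardinality.

Set Implicit Arguments.
Unset Strict Implicit.
Unset Printing Implicit Defensive.

Local Open Scope classical_set_scope.
Local Open Scope nat_scope.

(** Write [M] for the nonzero elements of [S], [e] for its multiplicity (the
    smallest minimal generator) and [n] for its embedding dimension.  A monomial
    computation gives H(h) = |hM \ (h+1)M| ([hilbertE]), so H(1) = n and the
    question is purely about [S].

    Adding [e] to a minimal generator [g] gives an element of 2M, which lies
    outside 3M unless [g] is a jump, meaning that g + e is in 3M.  The elements
    of 2M \ 3M of the Apery set of [e] (those not of the form e + s with s in
    [S]) are different from all these sums, so n - |jumps| + |Ap2| <= H(2)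
    ([card_layer2]), where Ap2 is the set of these Apery elements.  If
    H(2) < H(1), then |Ap2| < |jumps|.

    The main point is that |jumps| <= |Ap2| as soon as |Ap2| <= 2
    ([card_jump_le]).  For a jump [g], write g + e as a sum of as many minimal
    generators as possible; there are at least three summands, and the sum of
    any two of them lies in Ap2 ([apery2_pair]): otherwise one could either
    lengthen the factorization or cancel [e] and decompose [g].  When Ap2 has at
    most two elements there are so few pair sums that the summands are
    b, a, ..., a with at least two copies of [a] ([longest_fact_shape]), and
    sending [g] to a + b is injective ([jump_injects]).

    Hence |Ap2| >= 3 and |jumps| >= 4 when H(2) < H(1).  Finally [e] and the
    second smallest generator are not jumps, because a sum of three generators
    different from [e] is too large ([two_nonjumps]); so n >= |jumps| + 2 >= 6. *)

(** * Minimal generators and the sets hM *)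

Lemma nsg_generatedD (A : set nat) m n :
  nsg_generated A m -> nsg_generated A n -> nsg_generated A (m + n).
Proof.
move=> [s [As ->]] [t [At ->]]; exists (s ++ t); rewrite sumn_cat; split=> // a.
by rewrite mem_cat => /orP[/As|/At].
Qed.

Lemma min_gens_sub (S : numSemigroup) g : min_gens S g -> nsg_set S g.
Proof.
move=> Gg; rewrite -(min_gensP S).1; exists [:: g]; split; last by rewrite /= addn0.
by move=> a; rewrite inE => /eqP ->.
Qed.

(** Otherwise [g] could be dropped from the generators, against minimality. *)
Lemma min_gens_indep (S : numSemigroup) g :
  min_gens S g -> ~ nsg_generated (min_gens S `\ g) g.
Proof.
have [genG minG] := min_gensP S => Gg Bg.
have BG : min_gens S `\ g `<=` min_gens S by apply: subIsetl.
suff /(minG _ BG) GB : nsg_generated (min_gens S `\ g) = S.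
  by have := Gg; rewrite -GB => -[_]; apply.
apply/seteqP; split=> n; rewrite -{1}genG => -[s [As ->]].
  by exists s; split=> // a /As/BG.
elim: s As => [|a s IHs] As /=; first by exists [::].
apply: nsg_generatedD; last by apply: IHs => b bs; apply: As; rewrite inE bs orbT.
have Ga : min_gens S a by apply: As; rewrite mem_head.
have [->//|/eqP nag] := eqVneq a g.
by exists [:: a]; split; [move=> b; rewrite inE => /eqP -> | rewrite /= addn0].
Qed.

Lemma min_gens_gt0 (S : numSemigroup) g : min_gens S g -> 0 < g.
Proof.
by case: g => // /min_gens_indep []; exists [::].
Qed.

Lemma min_gens_irr (S : numSemigroup) g b c :
  min_gens S g -> nsg_set S b -> nsg_set S c -> g = b + c -> b = 0 \/ c = 0.
Proof.
move=> Gg Sb Sc gbc; apply: contrapT => /not_orP[/eqP b0 /eqP c0].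
suff sub x : nsg_set S x -> x < g -> nsg_generated (min_gens S `\ g) x.
  apply: (min_gens_indep Gg); rewrite {2}gbc.
  by apply: nsg_generatedD; apply: sub => //; lia.
rewrite -{1}(min_gensP S).1 => -[s [As ->]] ltg; exists s; split=> // a a_s.
split; first exact: As.
move=> /= ag; move: ltg; rewrite ltnNge -ag => /negP; apply.
by rewrite sumnE (big_rem a a_s) /= leq_addr.
Qed.

Lemma nsg_split (S : numSemigroup) n : nsg_set S n -> n <> 0 ->
  exists2 g, min_gens S g & exists2 s, nsg_set S s & n = g + s.
Proof.
rewrite -{1}(min_gensP S).1 => -[[|g s] [As ->]] //= _.
exists g; first by apply: As; rewrite mem_head.
exists (sumn s) => //; rewrite -(min_gensP S).1; exists s; split=> // a a_s.
by apply: As; rewrite inE a_s orbT.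
Qed.

(** The set hM.  Every element of [M] is a minimal generator plus an element of
    [S], so [(h+1)M] is obtained from [hM] by adding a single minimal generator,
    which is the form in which its elements get used. *)
Fixpoint mulM (S : numSemigroup) (h : nat) : set nat :=
  if h is h'.+1 then
    [set n | exists2 g, min_gens S g & exists2 s, mulM S h' s & n = g + s]
  else S.

Lemma mulM_absorb (S : numSemigroup) h a n :
  nsg_set S a -> mulM S h n -> mulM S h (a + n).
Proof.
move=> Sa; case: h => [|h]; first exact: nsgD.
elim: h n => [|h IHh] n [g Gg [s hs ->]]; exists g => //; exists (a + s); try lia.
  exact: nsgD.
exact: IHh.
Qed.

Lemma mulMS (S : numSemigroup) h n : mulM S h.+1 n -> mulM S h n.
Proof. by move=> [g /min_gens_sub Sg [s hs ->]]; apply: mulM_absorb. Qed.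

Lemma mulM_sub (S : numSemigroup) h n : mulM S h n -> nsg_set S n.
Proof. by elim: h n => // h IHh n /mulMS/IHh. Qed.

Lemma mulMD (S : numSemigroup) i j m n :
  mulM S i m -> mulM S j n -> mulM S (i + j) (m + n).
Proof.
elim: i m => [|i IHi] m; first exact: mulM_absorb.
by move=> [g Gg [s is_ ->]] jn; exists g => //; exists (s + n); [apply: IHi | lia].
Qed.

Lemma mulM1 (S : numSemigroup) n : nsg_set S n -> n <> 0 -> mulM S 1 n.
Proof. exact: nsg_split. Qed.

Lemma mulM_gen (S : numSemigroup) g : min_gens S g -> mulM S 1 g.
Proof. by move=> Gg; exists g => //; exists 0; [apply: nsg0 | rewrite addn0]. Qed.

Lemma mulM_sumn (S : numSemigroup) w :
  (forall a, a \in w -> min_gens S a) -> mulM S (size w) (sumn w).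
Proof.
elim: w => [|a w IHw] Gw /=; first exact: nsg0.
exists a; first by apply: Gw; rewrite mem_head.
by exists (sumn w) => //; apply: IHw => b bw; apply: Gw; rewrite inE bw orbT.
Qed.

Lemma mulM_leq (S : numSemigroup) h n : mulM S h n -> h <= n.
Proof.
by elim: h n => // h IHh n [g /min_gens_gt0 g0 [s /IHh hs ->]]; lia.
Qed.

Lemma mulM_factor (S : numSemigroup) h n : mulM S h n ->
  exists w s, [/\ forall a, a \in w -> min_gens S a, size w = h, nsg_set S s &
                  n = sumn w + s].
Proof.
elim: h n => [|h IHh] n; first by exists [::], n.
move=> [g Gg [_ /IHh[w [s [Gw <- Ss ->]]] ->]]; exists (g :: w), s.
split=> //=; last by rewrite addnA.
by move=> a; rewrite inE => /orP[/eqP->//|/Gw].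
Qed.

(** This makes the sets hM \ (h+1)M finite, so that counting them makes sense. *)
Lemma mulM_cofinite (S : numSemigroup) h : exists N, forall n, N <= n -> mulM S h n.
Proof.
elim: h => [|h [N hN]].
  have /finite_seqP[s es] := nsg_cofinite S.
  exists (\max_(i <- s) i).+1 => n lt_n; apply: contrapT => Sn.
  have ns : n \in s by have : (~` S) n by []; rewrite es.
  have : n <= \max_(i <- s) i by apply: (leq_bigmax_seq (F := id)).
  by rewrite leqNgt lt_n.
have [g Gg _] : mulM S 1 N.+1 by apply: mulM1 => //; apply/(@mulM_sub S h)/hN.
exists (g + N) => n leN; exists g => //.
by exists (n - g); [apply: hN|]; lia.
Qed.

Lemma finite_layer (S : numSemigroup) h : finite_set (mulM S h `\` mulM S h.+1).
Proof.
have [N hN] := mulM_cofinite S h.+1.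
apply: (sub_finite_set _ (finite_II N)) => n [_ nh] /=.
by rewrite ltnNge; apply/negP => /hN.
Qed.

(** The value H(1) is the embedding dimension. *)
Lemma layer1 (S : numSemigroup) : mulM S 1 `\` mulM S 2 = min_gens S.
Proof.
apply/seteqP; split=> [_ [[g Gg [s Ss ->]] n2]|g Gg].
  have [->|/eqP s0] := eqVneq s 0; first by rewrite addn0.
  by case: n2; exists g => //; exists s => //; apply: mulM1.
split; first exact: mulM_gen.
move=> [a Ga [_ [b Gb [s Ss ->]] gab]].
have Sbs : nsg_set S (b + s) by apply: nsgD (min_gens_sub Gb) Ss.
have := min_gens_gt0 Ga; have := min_gens_gt0 Gb.
have := min_gens_irr Gg (min_gens_sub Ga) Sbs gab; lia.
Qed.

(** * Longest factorizations *)

(** Since [x] is not in the set (size w + 1)M, no factorization of [x] into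
    minimal generators is longer than [w]. *)
Definition longest_fact (S : numSemigroup) (x : nat) (w : seq nat) : Prop :=
  [/\ forall a, a \in w -> min_gens S a, sumn w = x & ~ mulM S (size w).+1 x].

(** For the largest [r] with [x] in rM, write [x] as a sum of [r] minimal
    generators and some [s] in [S]; a nonzero [s] would put [x] in (r+1)M. *)
Lemma longest_fact_exists (S : numSemigroup) h x : mulM S h x ->
  exists2 w, longest_fact S x w & h <= size w.
Proof.
move=> hx; pose P := [pred r | `[< mulM S r x >]].
have exP : exists r, P r by exists h; apply/asboolP.
have bound r : P r -> r <= x by move=> /asboolP /mulM_leq.
case: (ex_maxnP exP bound) => r /asboolP rx rmax.
have [w [s [Gw sw Ss xws]]] := mulM_factor rx.
have maxr : ~ mulM S r.+1 x by move=> /asboolP /rmax; rewrite ltnn.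
exists w; last by rewrite sw; apply/rmax/asboolP.
split=> //; last by rewrite sw.
have [s0|/eqP s0] := eqVneq s 0; first by rewrite xws s0 addn0.
case: maxr; rewrite xws -sw -addn1; apply: mulMD; first exact: mulM_sumn.
exact: mulM1.
Qed.

Lemma longest_fact_perm (S : numSemigroup) x v w :
  perm_eq v w -> longest_fact S x v -> longest_fact S x w.
Proof.
move=> vw [Gv sv nv]; split; last by rewrite -(perm_size vw).
  by move=> a; rewrite -(perm_mem vw); apply: Gv.
by rewrite -sv !sumnE; apply/perm_big; rewrite perm_sym.
Qed.

(** Exchanging a pair of summands for another pair with the same sum keeps both
    the sum and the length; it produces new pair sums to which [apery2_pair]
    applies. *)
Lemma longest_fact_subst (S : numSemigroup) x a b c d w :
    min_gens S c -> min_gens S d -> a + b = c + d ->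
  longest_fact S x [:: a, b & w] -> longest_fact S x [:: c, d & w].
Proof.
move=> Gc Gd e [Gw sw nw]; split=> //=; last by rewrite -sw /= !addnA e.
move=> y; rewrite !inE => /or3P[/eqP->//|/eqP->//|yw].
by apply: Gw; rewrite !inE yw !orbT.
Qed.

(** * Elements of order two of the Apery set *)

Definition multiplicity (S : numSemigroup) (e : nat) : Prop :=
  min_gens S e /\ forall g, min_gens S g -> e <= g.

Definition apery2 (S : numSemigroup) (e : nat) : set nat :=
  [set x | [/\ mulM S 2 x, ~ mulM S 3 x & ~ exists2 s, nsg_set S s & x = e + s]].

(** A minimal generator has order 1, so one expects g + e to have order 2; at a
    jump the order increases by at least two, and the class of [t^e] kills the
    class of [t^g] in the associated graded ring. *)
Definition jump (S : numSemigroup) (e : nat) : set nat :=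
  [set g | min_gens S g /\ mulM S 3 (g + e)].

(** If a + b were in 3M, replacing it would lengthen the factorization.  If
    a + b = e + s, then cancelling [e] gives g = s + sumn w with [w] nonempty;
    as [g] is irreducible, s = 0 and a + b = e, against the minimality of [e]. *)
Lemma apery2_pair (S : numSemigroup) e g a b w :
    multiplicity S e -> min_gens S g -> w <> [::] ->
  longest_fact S (g + e) [:: a, b & w] -> apery2 S e (a + b).
Proof.
move=> [Ge emin] Gg w0 [Gw sw nw].
have Ga : min_gens S a by apply: Gw; rewrite inE eqxx.
have Gb : min_gens S b by apply: Gw; rewrite !inE eqxx orbT.
have Gw' c : c \in w -> min_gens S c by move=> cw; apply: Gw; rewrite !inE cw !orbT.
split.
- by exists a => //; exists b => //; apply: mulM_gen.
- by move=> ab3; apply: nw; rewrite -sw /= addnA;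
  apply: (mulMD ab3); apply: mulM_sumn.
move=> [s Ss abes].
have Sw : nsg_set S (sumn w) by apply: mulM_sub (mulM_sumn Gw').
have gsw : g = s + sumn w by move: sw => /=; lia.
have sumw0 : sumn w <> 0.
  case: w w0 Gw' {Gw sw nw Sw gsw} => // c w _ Gw' /=.
  by have := min_gens_gt0 (Gw' c (mem_head _ _)); lia.
have [s0|//] := min_gens_irr Gg Ss Sw gsw.
have := emin _ Ga; have := min_gens_gt0 Gb; lia.
Qed.

Lemma apery2_not_mult (S : numSemigroup) e b : min_gens S b -> ~ apery2 S e (e + b).
Proof. by move=> Gb [_ _]; apply; exists b => //; apply: min_gens_sub. Qed.

(** Stated without cardinals, so that three pair sums can be fed to it. *)
Definition at_most_two (A : set nat) : Prop :=
  forall x y z, A x -> A y -> A z -> [\/ x = y, x = z | y = z].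

(** Three distinct summands have three distinct pair sums, so some [a] occurs
    twice.  Two further summands [x], [y] different from [a] are impossible:
    a + a, a + x, a + y are distinct when [x] and [y] are, and a + a, a + x,
    x + x are distinct when x = y.  So at most one summand differs from [a]. *)
Lemma longest_fact_shape (S : numSemigroup) e g :
    multiplicity S e -> at_most_two (apery2 S e) -> jump S e g ->
  exists a b m, longest_fact S (g + e) [:: b, a, a & nseq m a].
Proof.
move=> em A2 [Gg /longest_fact_exists[w fw]].
have pair a b c v : perm_eq w [:: a, b, c & v] -> apery2 S e (a + b).
  by move=> /longest_fact_perm/(_ fw); apply: apery2_pair.
move=> w3.
have [a [c [v wv]]] : exists a c v, perm_eq w [:: a, a, c & v].
  case: w fw pair w3 => [|x [|y [|z v]]]//= _ pair _.
  have /pair xy : perm_eq [:: x, y, z & v] [:: x, y, z & v] by [].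
  have pxz : perm_eq [:: x, y, z & v] [:: x, z, y & v].
    by apply/permP => p /=; lia.
  have pyz : perm_eq [:: x, y, z & v] [:: y, z, x & v].
    by apply/permP => p /=; lia.
  have [/addnI yz|exy|exy] := A2 _ _ _ xy (pair _ _ _ _ pxz) (pair _ _ _ _ pyz).
  - by subst z; exists y, x, v; apply/permP => p /=; lia.
  - have -> : z = x by lia.
    by exists x, y, v; apply/permP => p /=; lia.
  - have -> : y = x by lia.
    by exists x, z, v; apply/permP => p /=; lia.
pose u := c :: v.
have aa : apery2 S e (a + a) := pair _ _ _ _ wv.
have few : size (filter (predC (pred1 a)) u) <= 1.
  rewrite leqNgt; apply/negP.
  case E: filter => [|x [|y t]]// _.
  have [xa ya] : x != a /\ y != a.
    have : all (predC (pred1 a)) (filter (predC (pred1 a)) u) by apply: filter_all.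
    by rewrite E /= => /and3P[].
  have wu : perm_eq w [:: a, a, x, y & t ++ filter (pred1 a) u].
    rewrite (perm_trans wv)// !perm_cons -/u -(perm_filterC (pred1 a) u) E perm_catC.
    by [].
  have ax : apery2 S e (a + x).
    apply: (pair _ _ a (y :: t ++ filter (pred1 a) u)).
    by rewrite (perm_trans wu)//; apply/permP => p /=; lia.
  have ay : apery2 S e (a + y).
    apply: (pair _ _ a (x :: t ++ filter (pred1 a) u)).
    by rewrite (perm_trans wu)//; apply/permP => p /=; lia.
  have xy : apery2 S e (x + y).
    apply: (pair _ _ a (a :: t ++ filter (pred1 a) u)).
    by rewrite (perm_trans wu)//; apply/permP => p /=; lia.
  by have := A2 _ _ _ aa ax ay; have := A2 _ _ _ aa ax xy => - [] + []; lia.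
have wu : perm_eq w [:: a, a & nseq (count_mem a u) a ++ filter (predC (pred1 a)) u].
  have -> : nseq (count_mem a u) a = filter (pred1 a) u.
    by rewrite -size_filter; apply/esym/all_pred1P/filter_all.
  by rewrite (perm_trans wv)// !perm_cons -/u perm_sym perm_filterC.
case E: (filter _ u) few wu => [|b [|//]] _ wu.
- have all_a : all (pred1 a) u.
    rewrite all_count -size_filter -(cats0 (filter _ _)) -E size_cat.
    by rewrite !size_filter count_predC.
  have [m um] : exists m, count_mem a u = m.+1.
    by exists (count_mem a v); move: all_a => /= /andP[-> _].
  exists a, a, m; apply: longest_fact_perm fw.
  by rewrite um cats0 in wu.
- exists a, b, (count_mem a u); apply: longest_fact_perm fw.
  by rewrite (perm_trans wu)//; apply/permP => p /=; rewrite count_cat /=; lia.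
Qed.

(** * Comparing jumps with the Apery set *)

Lemma nsgM (S : numSemigroup) n a : nsg_set S a -> nsg_set S (n * a).
Proof. by move=> Sa; elim: n => [|n IHn]; [apply: nsg0 | apply: nsgD]. Qed.

(** If a + b = 2c, exchanging [b], [a] for [c], [c] makes a + c a pair sum; it
    lies strictly between the pair sums 2a and 2c when a <> c. *)
Lemma no_double_pair (S : numSemigroup) e g a b c m :
    multiplicity S e -> at_most_two (apery2 S e) -> min_gens S g ->
    longest_fact S (g + e) [:: b, a, a & nseq m a] ->
    min_gens S c -> a + b = c + c -> a = c.
Proof.
move=> em A2 Gg fw Gc abcc.
have aa : apery2 S e (a + a).
  apply: (apery2_pair (w := b :: nseq m a) em Gg) => //; apply: longest_fact_perm fw.
  by apply/permP => p /=; lia.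
have bacc : b + a = c + c by rewrite addnC.
have fw' := longest_fact_subst Gc Gc bacc fw.
have cc : apery2 S e (c + c) by apply: apery2_pair em Gg _ fw'.
have ac : apery2 S e (a + c).
  apply: (apery2_pair (w := c :: nseq m a) em Gg) => //; apply: longest_fact_perm fw'.
  by apply/permP => p /=; lia.
by have [] := A2 _ _ _ aa ac cc; lia.
Qed.

(** Let [g], [h] have summands b, a, ..., a and d, c, ..., c with a + b = c + d.
    Among the pair sums 2a, 2c and a + b two are equal, and [no_double_pair]
    turns this into a = c, hence b = d.  Then [g] and [h] differ by a multiple
    of the generator [a], so they are equal by irreducibility. *)
Lemma jump_injects (S : numSemigroup) e :
    multiplicity S e -> at_most_two (apery2 S e) ->
  exists2 q : nat -> nat, forall g, jump S e g -> apery2 S e (q g) &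
    forall g h, jump S e g -> jump S e h -> q g = q h -> g = h.
Proof.
move=> em A2.
have /choice[f fP] g : exists abm : nat * nat * nat, jump S e g ->
    longest_fact S (g + e) [:: abm.1.2, abm.1.1, abm.1.1 & nseq abm.2 abm.1.1].
  have [Jg|nJ] := pselect (jump S e g); last by exists (0, 0, 0).
  by have [a [b [m fw]]] := longest_fact_shape em A2 Jg; exists (a, b, m).
exists (fun g => (f g).1.1 + (f g).1.2) => [g Jg|g h Jg Jh].
  by rewrite addnC; apply: apery2_pair em Jg.1 _ (fP g Jg).
move: (fP g Jg) (fP h Jh).
case: (f g) (f h) => [[a b] m] [[c d] n] /= fg fh abcd.
have [Gg Gh] := (Jg.1, Jh.1).
have aa : apery2 S e (a + a).
  apply: (apery2_pair (w := b :: nseq m a) em Gg) => //; apply: longest_fact_perm fg.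
  by apply/permP => p /=; lia.
have cc : apery2 S e (c + c).
  apply: (apery2_pair (w := d :: nseq n c) em Gh) => //; apply: longest_fact_perm fh.
  by apply/permP => p /=; lia.
have ab : apery2 S e (a + b).
  by rewrite addnC; apply: apery2_pair em Gg _ fg.
have Ga : min_gens S a by case: fg => Gw _ _; apply: Gw; rewrite !inE eqxx orbT.
have Gc : min_gens S c by case: fh => Gw _ _; apply: Gw; rewrite !inE eqxx orbT.
have ac : a = c.
  have [|aa_ab|cc_ab] := A2 _ _ _ aa cc ab; first by lia.
    by apply/esym; apply: (no_double_pair em A2 Gh fh Ga); lia.
  by apply: (no_double_pair em A2 Gg fg Gc); lia.
have bd : b = d by lia.
subst c d.
have [_ sg _] := fg; have [_ sh _] := fh.
rewrite /= !sumn_nseq in sg sh.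
have Sa := min_gens_sub Ga; have a0 := min_gens_gt0 Ga.
have nd x y k l : min_gens S x -> min_gens S y ->
    b + (a + (a + a * k)) = x + e -> b + (a + (a + a * l)) = y + e -> k <= l -> x = y.
  move=> Gx Gy ex ey kl.
  have yx : y = x + (l - k) * a by nia.
  have [x0|k0] := min_gens_irr Gy (min_gens_sub Gx) (nsgM (l - k) Sa) yx; last by lia.
  by have := min_gens_gt0 Gx; rewrite x0.
have [mn|/ltnW nm] := leqP m n; first exact: nd sg sh mn.
exact/esym/(nd _ _ _ _ _ _ sh sg nm).
Qed.

Lemma multiplicity_exists (S : numSemigroup) : exists e, multiplicity S e.
Proof.
have [N hN] := mulM_cofinite S 1.
have exG : exists g, `[< min_gens S g >].
  by have [g Gg _] := hN N (leqnn N); exists g; apply/asboolP.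
case: (ex_minnP exG) => e /asboolP Ge emin; exists e; split=> // g Gg.
by apply: emin; apply/asboolP.
Qed.

Lemma jump_factors (S : numSemigroup) e g : multiplicity S e -> jump S e g ->
  exists a b c s, [/\ min_gens S a /\ a <> e, min_gens S b /\ b <> e,
    min_gens S c /\ c <> e & g + e = a + b + c + s].
Proof.
move=> em [Gg /longest_fact_exists[[|a [|b [|c w]]]// fw _]].
have not_e x y z v : perm_eq [:: a, b, c & w] [:: x, y, z & v] ->
    min_gens S x /\ x <> e.
  move=> /longest_fact_perm/(_ fw) fx; have [Gw _ _] := fx.
  split=> [|xe]; first by apply: Gw; rewrite mem_head.
  apply: (@apery2_not_mult S e y); first by apply: Gw; rewrite !inE eqxx orbT.
  by rewrite -{2}xe; apply: apery2_pair em Gg _ fx.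
exists a, b, c, (sumn w); split.
- exact: not_e (perm_refl _).
- by apply: (not_e b a c w); apply/permP => p /=; lia.
- by apply: (not_e c a b w); apply/permP => p /=; lia.
- by case: fw => _ /= <- _; lia.
Qed.

(** By [jump_factors], f + e is at least the sum of three generators different
    from [e] when [f] is a jump.  This exceeds 2e, and if [f] is the smallest
    generator after [e] it is at least 3f, which exceeds f + e. *)
Lemma two_nonjumps (S : numSemigroup) e g : multiplicity S e -> jump S e g ->
  exists f, [/\ min_gens S f, f <> e, ~ jump S e f & ~ jump S e e].
Proof.
move=> em Jg; have [Ge emin] := em; have e0 := min_gens_gt0 Ge.
have exG : exists f, `[< min_gens S f /\ f <> e >].
  by have [a [_ [_ [_ [Ga _ _ _]]]]] := jump_factors em Jg; exists a; apply/asboolP.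
case: (ex_minnP exG) => f /asboolP[Gf fe] fmin; exists f; split=> // J;
  have [a [b [c [s [Ga Gb Gc sum]]]]] := jump_factors em J.
  have := fmin a (asboolT Ga); have := fmin b (asboolT Gb).
  have := fmin c (asboolT Gc); have := emin f Gf; lia.
have := emin _ Ga.1; have := emin _ Gb.1; have := emin _ Gc.1; lia.
Qed.

Lemma finite_jump (S : numSemigroup) e : finite_set (jump S e).
Proof. by apply: sub_finite_set (finite_min_gens S) => g []. Qed.

Lemma finite_apery2 (S : numSemigroup) e : finite_set (apery2 S e).
Proof. by apply: sub_finite_set (finite_layer S 2) => x []. Qed.

Local Notation card A := (#|` fset_set A|).

Lemma card_jump_embdim (S : numSemigroup) e :
  multiplicity S e -> 0 < card (jump S e) -> card (jump S e) + 2 <= embdim S.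
Proof.
move=> em; rewrite cardfs_gt0 => /fset0Pn[g].
rewrite in_fset_set; last exact: finite_jump.
move=> /set_mem Jg; have [f [Gf fe nf ne]] := two_nonjumps em Jg.
have fG := finite_min_gens S; have fJ := finite_jump S e.
have inJ x : x \in fset_set (jump S e) -> jump S e x.
  by rewrite in_fset_set// => /set_mem.
have -> : card (jump S e) + 2 = #|` e |` (f |` fset_set (jump S e))|%fset.
  rewrite !cardfsU1 !inE.
  have -> : f \in fset_set (jump S e) = false by apply/negP => /inJ.
  have -> : e \in fset_set (jump S e) = false by apply/negP => /inJ.
  by rewrite orbF; case: eqP => [ef|_]; [case: fe | rewrite /=; lia].
apply: fsubset_leq_card; apply/fsubsetP => x; rewrite !inE !in_fset_set//.
by case/or3P => [/eqP->|/eqP->|/set_mem[Gx _]]; apply/mem_set => //; exact: em.1.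
Qed.

(** The set 2M \ 3M contains, disjointly, the Apery elements of order two and
    the sums e + g for the minimal generators [g] that are not jumps. *)
Lemma card_layer2 (S : numSemigroup) e : multiplicity S e ->
  card (apery2 S e) + embdim S <=
    card (mulM S 2 `\` mulM S 3) + card (jump S e).
Proof.
move=> [Ge emin]; have fG := finite_min_gens S; have fJ := finite_jump S e.
have fA := finite_apery2 S e; have fL := finite_layer S 2.
have -> : embdim S = card (jump S e) + card (min_gens S `\` jump S e).
  rewrite fset_setD// /embdim -(cardfsID (fset_set (jump S e))); congr (_ + _).
  by rewrite -fset_setI//; congr (#|` fset_set _|); apply/setIidPr => x [].
rewrite addnCA addnC leq_add2r.
have fN : finite_set (min_gens S `\` jump S e) by apply: finite_setD.
set N := fset_set (_ `\` jump _ _); set A := fset_set (apery2 S e).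
have -> : #|` N| = #|` [fset (e + g)%N | g in N]%fset|.
  by rewrite card_imfset//; apply: addnI.
rewrite -cardfsUI.
have -> : (A `&` [fset (e + g)%N | g in N] = fset0)%fset.
  apply/fsetP => x; rewrite !inE; apply/negP => /andP[].
  rewrite in_fset_set// => /set_mem Ax /imfsetP[g /=].
  rewrite in_fset_set// => /set_mem[Gg _] xeg.
  by rewrite xeg in Ax; apply: apery2_not_mult Gg Ax.
rewrite cardfs0 addn0; apply: fsubset_leq_card; apply/fsubsetP => x.
rewrite !inE !in_fset_set// => /orP[/set_mem[x2 x3 _]|/imfsetP[g /=]].
  exact/mem_set.
rewrite in_fset_set// => /set_mem[Gg nJ] ->; apply/mem_set; split.
  by exists e => //; exists g => //; apply: mulM_gen.
by rewrite addnC => eg3; apply: nJ.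
Qed.

Lemma card_jump_le (S : numSemigroup) e : multiplicity S e ->
  card (apery2 S e) <= 2 -> card (jump S e) <= card (apery2 S e).
Proof.
move=> em le2; have fA := finite_apery2 S e; have fJ := finite_jump S e.
have [x y z Ax Ay Az|q qA q_inj] := @jump_injects S e em.
  have [->|/eqP xy] := eqVneq x y; first by constructor 1.
  have [->|/eqP xz] := eqVneq x z; first by constructor 2.
  have [->|/eqP yz] := eqVneq y z; first by constructor 3.
  suff : 2 < card (apery2 S e) by rewrite ltnNge le2.
  have <- : #|` x |` (y |` [fset z])|%fset = 3.
    by rewrite !cardfsU1 cardfs1 !inE; lia.
  apply: fsubset_leq_card; apply/fsubsetP => t; rewrite !inE in_fset_set//.
  by case/or3P => /eqP ->; apply/mem_set.
have <- : #|` [fset q g | g in fset_set (jump S e)]%fset| = card (jump S e).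
  apply: card_in_imfset => g h Jg Jh; apply: q_inj; apply/set_mem.
    by rewrite -in_fset_set.
  by rewrite -in_fset_set.
apply: fsubset_leq_card; apply/fsubsetP => x /imfsetP[g /=]; rewrite !in_fset_set//.
by move=> /set_mem Jg ->; apply/mem_set/qA.
Qed.

Lemma embdim_gt5 (S : numSemigroup) :
    card (mulM S 2 `\` mulM S 3) < card (mulM S 1 `\` mulM S 2) ->
  5 < embdim S.
Proof.
rewrite layer1 -/(embdim S) => dec; have [e em] := multiplicity_exists S.
have := card_layer2 em; have := card_jump_le em; have := card_jump_embdim em.
lia.
Qed.

(** * The Hilbert function of the semigroup ring *)

Import GRing.Theory.
Local Open Scope ring_scope.

(** The quotient A / B is identified with [k^d] by a linear map that vanishes
    exactly on [B] and is onto on [A].  A family representing a basis of A / B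
    then has for images the rows of a square invertible matrix, which fixes its
    size. *)
Lemma quo_dimE (k : fieldType) (V : lmodType k) (A B : set V) (d : nat)
    (phi : {linear V -> 'rV[k]_d}) :
    A 0 -> (forall c x y, A x -> A y -> A (c *: x + y)) ->
    (forall x, A x -> (B x <-> phi x = 0)) ->
    (forall u, exists2 x, A x & phi x = u) ->
  quo_dim A B = d.
Proof.
move=> A0 Alin Bphi phi_surj.
have Asum n (c : 'I_n -> k) v : (forall i, A (v i)) -> A (\sum_i c i *: v i).
  by move=> Av; elim/big_rec: _ => // i x _; apply: Alin.
have phi_sum n (c : 'I_n -> k) v :
    phi (\sum_i c i *: v i) = (\row_i c i) *m \matrix_i phi (v i).
  rewrite linear_sum mulmx_sum_row; apply: eq_bigr => i _.
  by rewrite linearZ rowK mxE.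
apply: xget_unique => [|n [v [Av Bgen Bfree]]].
  have /choice[v vP] (i : 'I_d) : exists x, A x /\ phi x = delta_mx 0 i.
    by have [x] := phi_surj (delta_mx 0 i); exists x.
  have Av i : A (v i) := (vP i).1.
  have phi_v c : phi (\sum_i c i *: v i) = \row_i c i.
    rewrite phi_sum -[RHS]mulmx1; congr (_ *m _); apply/row_matrixP => i.
    by rewrite rowK (vP i).2 row1.
  exists v; split=> // [x Ax|c /Bphi Bc i].
    exists (phi x 0); apply/Bphi; last first.
      by rewrite linearB /= phi_v; apply/rowP => i; rewrite !mxE subrr.
    by rewrite addrC -scaleN1r; apply: Alin => //; apply: Asum.
  have /rowP/(_ i) : \row_i c i = 0 by rewrite -phi_v; apply/Bc/Asum.
  by rewrite !mxE.
pose M := \matrix_i phi (v i).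
have Mfree : row_free M.
  apply: inj_row_free => c cM0; apply/rowP => i; rewrite mxE.
  apply: (Bfree (c 0)); apply/Bphi; first exact: Asum.
  by rewrite phi_sum -/M -[RHS]cM0; congr (_ *m _); apply/rowP => j; rewrite mxE.
have Mfull : row_full M.
  rewrite -sub1mx; apply/row_subP => i.
  have [x Ax <-] := phi_surj (row i 1%:M); have [c /Bphi Bc] := Bgen x Ax.
  have /eqP : phi (x - \sum_i c i *: v i) = 0.
    by apply: Bc; rewrite addrC -scaleN1r; apply: Alin => //; apply: Asum.
  by rewrite linearB /= phi_sum subr_eq0 => /eqP ->; apply: submxMl.
by rewrite -(eqP Mfree) (eqP Mfull).
Qed.

Definition coef (k : fieldType) (S : numSemigroup) (f : sgring k S) (n : nat) : k :=
  fps_coef (sgring_val f) n.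

(** The power series supported in hM; it is the h-th power of the maximal ideal
    by [ideal_expE]. *)
Definition supported (k : fieldType) (S : numSemigroup) (h : nat) : set (sgring k S) :=
  [set f | forall n, ~ mulM S h n -> coef f n = 0].

Lemma coef0 (k : fieldType) (S : numSemigroup) n : coef (0 : sgring k S) n = 0.
Proof. by []. Qed.

Lemma coefD (k : fieldType) (S : numSemigroup) (f g : sgring k S) n :
  coef (f + g) n = coef f n + coef g n.
Proof. by []. Qed.

Lemma coefZ (k : fieldType) (S : numSemigroup) c (f : sgring k S) n :
  coef (c *: f) n = c * coef f n.
Proof. by []. Qed.

Lemma coefM (k : fieldType) (S : numSemigroup) (f g : sgring k S) n :
  coef (f * g) n = \sum_(i < n.+1) coef f i * coef g (n - i)%N.
Proof. by []. Qed.

Lemma coef_sum (k : fieldType) (S : numSemigroup) m (F : 'I_m -> sgring k S) n :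
  coef (\sum_i F i) n = \sum_i coef (F i) n.
Proof. by apply: (big_morph (fun f => coef f n)). Qed.

Lemma coef_inj (k : fieldType) (S : numSemigroup) (f g : sgring k S) :
  coef f =1 coef g -> f = g.
Proof. by move=> fg; apply/val_inj/fpsP. Qed.

Lemma supported0 (k : fieldType) (S : numSemigroup) (f : sgring k S) :
  supported 0 f.
Proof. by move=> n /= Sn; have /asboolP := valP f; apply. Qed.

Lemma sgring_of_coef (k : fieldType) (S : numSemigroup) (c : nat -> k) :
  (forall n, ~ nsg_set S n -> c n = 0) -> exists f : sgring k S, coef f =1 c.
Proof.
move=> c0; have Sc : Fps c \in fps_supp (k := k) S by apply/asboolP.
by exists (SgRing Sc).
Qed.

Lemma supportedD (k : fieldType) (S : numSemigroup) h (f g : sgring k S) :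
  supported h f -> supported h g -> supported h (f + g).
Proof. by move=> hf hg n nh; rewrite coefD hf// hg// addr0. Qed.

Lemma supportedM (k : fieldType) (S : numSemigroup) i j (f g : sgring k S) :
  supported i f -> supported j g -> supported (i + j) (f * g).
Proof.
move=> fi gj n nij; rewrite coefM big1// => -[m /= mn] _.
have [im|/fi->] := pselect (mulM S i m); last by rewrite mul0r.
rewrite gj ?mulr0// => jm; apply: nij.
by rewrite -(subnKC (mn : (m <= n)%N)); apply: mulMD.
Qed.

Lemma ideal_gen_supported (k : fieldType) (S : numSemigroup) h (X : set (sgring k S)) :
  X `<=` supported h -> ideal_gen X `<=` supported h.
Proof.
move=> Xh _ [n [a [y [Xy ->]]]]; elim/big_rec: _ => [m _|i x _]; first exact: coef0.
by apply: supportedD; apply: (supportedM (i := 0)); [apply: supported0 | apply: Xh].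
Qed.

Lemma ideal_gen_incl (R : comNzRingType) (X : set R) : X `<=` ideal_gen X.
Proof.
move=> x Xx; exists 1%N, (fun=> 1), (fun=> x); split=> //.
by rewrite big_ord1 mul1r.
Qed.

Lemma sgring_max_supported (k : fieldType) (S : numSemigroup) :
  sgring_max k S `<=` supported 1.
Proof.
apply: ideal_gen_supported => x [g Gg xg] n n1; rewrite /coef xg /=.
by case: eqP => // ng; case: n1; rewrite ng; apply: mulM_gen.
Qed.

Lemma monomial_exists (k : fieldType) (S : numSemigroup) g : min_gens S g ->
  exists2 x : sgring k S, sgring_max k S x &
    forall f n, coef (x * f) n = if (g <= n)%N then coef f (n - g) else 0.
Proof.
move=> Gg; have [|x xE] := @sgring_of_coef k S (fun n => (n == g)%:R).
  by move=> n Sn; case: eqP => // ng; case: Sn; rewrite ng; apply: min_gens_sub.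
exists x => [|f n].
  by apply: ideal_gen_incl; exists g => //; apply/fpsP.
rewrite coefM; case: ifP => gn.
  rewrite (bigD1 (Ordinal (gn : g < n.+1)%N))//= xE eqxx mul1r big1 ?addr0// => i.
  by rewrite -val_eqE /= xE => /negPf ->; rewrite mul0r.
rewrite big1// => i _; rewrite xE; case: eqP => [ig|]; last by rewrite mul0r.
by move: gn; rewrite -ig -ltnS ltn_ord.
Qed.

(** An element of the ideal is a finite sum of products, while a series
    supported in (h+1)M has infinitely many terms.  Choosing for each exponent
    [n] a generator [gam n] with n - gam n in hM, and grouping the terms of [f]
    by the value of [gam], writes [f] as the sum over the finitely many minimal
    generators [g] of [t^g] times a series supported in hM. *)
Lemma supportedS_mul (k : fieldType) (S : numSemigroup) h :
  supported h.+1 `<=` ideal_mul (sgring_max k S) (supported h).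
Proof.
move=> f fh; have fG := finite_min_gens S.
have /choice[gam gamP] n : exists g, mulM S h.+1 n ->
    min_gens S g /\ exists2 s, mulM S h s & n = (g + s)%N.
  have [[g Gg sh]|nh] := pselect (mulM S h.+1 n); last by exists 0%N.
  by exists g.
pose s : seq nat := fset_set (min_gens S).
have Gs g : g \in s -> min_gens S g by rewrite in_fset_set// => /set_mem.
have /choice[y yP] (i : 'I_(size s)) : exists y : sgring k S,
    [set x * z | x in sgring_max k S & z in supported h] y /\
    forall n, coef y n = if gam n == nth 0%N s i then
                           (if (nth 0%N s i <= n)%N then coef f n else 0) else 0.
  set g := nth 0%N s i; have Gg : min_gens S g by apply/Gs/mem_nth.
  have [x mx xE] := monomial_exists k Gg.
  pose c m := if gam (g + m)%N == g then coef f (g + m) else 0.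
  have ch m : ~ mulM S h m -> c m = 0.
    rewrite /c; case: eqP => // gamg nm; apply: fh => /gamP[_ [m' hm']].
    by rewrite gamg => /addnI mm'; apply: nm; rewrite mm'.
  have [|z zE] := @sgring_of_coef k S c.
    by move=> m Sm; apply: ch => /mulM_sub.
  exists (x * z); split; first by exists x => //; exists z => // m /ch <-.
  move=> n; rewrite xE; case: leqP => gn; last by rewrite if_same.
  by rewrite zE /c subnKC.
exists (size s), (fun=> 1), y; split=> [i|]; first exact: (yP i).1.
apply: coef_inj => n; rewrite coef_sum.
under eq_bigr => i _ do rewrite mul1r (yP i).2.
have [hn|nh] := pselect (mulM S h.+1 n); last first.
  by rewrite (fh n nh) big1// => i _; rewrite !if_same.
have [Gg [t _ nE]] := gamP n hn.
have gs : gam n \in s by rewrite in_fset_set//; apply/mem_set.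
have is_ : (index (gam n) s < size s)%N by rewrite index_mem.
have le_n : (gam n <= n)%N by rewrite {2}nE leq_addr.
rewrite (bigD1 (Ordinal is_))//= nth_index// eqxx le_n big1 ?addr0// => i.
rewrite -val_eqE /= => /negP ne; case: eqP => // gi; case: ne.
by rewrite gi index_uniq//; apply: fset_uniq.
Qed.

Lemma ideal_expE (k : fieldType) (S : numSemigroup) h :
  ideal_exp (sgring_max k S) h = supported h.
Proof.
elim: h => [|h IHh] /=.
  by apply/seteqP; split=> f // _; apply: supported0.
rewrite IHh; apply/seteqP; split; last exact: supportedS_mul.
apply: ideal_gen_supported => _ [x mx [y yh <-]].
by apply: (supportedM (i := 1)) => //; apply: sgring_max_supported.
Qed.

(** When [s] lists hM \ (h+1)M, these coordinates identify the quotient of the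
    h-th by the (h+1)-st power of the maximal ideal with a space of rows. *)
Definition coef_row (k : fieldType) (S : numSemigroup) (s : seq nat)
    (f : sgring k S) : 'rV[k]_(size s) := \row_j coef f (nth 0%N s j).

Fact coef_row_linear (k : fieldType) (S : numSemigroup) (s : seq nat) :
  linear (@coef_row k S s).
Proof. by move=> a f g; apply/rowP => j; rewrite !mxE. Qed.

HB.instance Definition _ (k : fieldType) (S : numSemigroup) (s : seq nat) :=
  GRing.isLinear.Build k (sgring k S) 'rV[k]_(size s) *:%R (@coef_row k S s)
    (@coef_row_linear k S s).

Lemma hilbertE (k : fieldType) (S : numSemigroup) h :
  hilbert (sgring_max k S) h = #|` fset_set (mulM S h `\` mulM S h.+1)|.
Proof.
rewrite /hilbert !ideal_expE; pose s : seq nat := fset_set (mulM S h `\` mulM S h.+1).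
have fL := finite_layer S h.
have sP n : n \in s <-> mulM S h n /\ ~ mulM S h.+1 n.
  by rewrite in_fset_set//; split=> [/set_mem//|nL]; apply/mem_set.
apply: (quo_dimE (phi := @coef_row k S s)).
- by move=> n _; apply: coef0.
- by move=> c f g fh gh n nh; rewrite coefD coefZ fh// gh// mulr0 addr0.
- move=> f fh; split=> [fh1|f0 n nh1].
    by apply/rowP => j; rewrite !mxE fh1//; have /sP[] := mem_nth 0%N (ltn_ord j).
  have [hn|] := pselect (mulM S h n); last exact: fh.
  have ns : n \in s by apply/sP.
  have is_ : (index n s < size s)%N by rewrite index_mem.
  by have /rowP/(_ (Ordinal is_)) := f0; rewrite !mxE /= nth_index.
move=> u; pose c n := if insub (index n s) is Some j then u 0 j else 0.
have ch n : ~ mulM S h n -> c n = 0.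
  move=> nh; rewrite /c insubN// index_mem; apply/negP => /sP[hn _]; exact: nh.
have [|f fE] := @sgring_of_coef k S c.
  by move=> n Sn; apply: ch => /mulM_sub.
exists f => [n /ch <-//|]; apply/rowP => j.
by rewrite !mxE fE /c index_uniq ?fset_uniq// valK.
Qed.

Theorem corollary2p12 (k : fieldType) (S : numSemigroup) :
  infinite_set [set: k] ->
  (hilbert (sgring_max k S) 2 < hilbert (sgring_max k S) 1)%N ->
  (5 < embdim S)%N.
Proof. by move=> _; rewrite !hilbertE; apply: embdim_gt5. Qed.
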